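(* Let $S$ be a monothetic topological monoid which is locally compact at its identity $1$. If $S$ is a submonoid of a Hausdorff quasitopological group $G$, then $S$ is a compact topological group.
   Context: A topological monoid is a semigroup with identity endowed with a topology such that the multiplication is jointly continuous. $S$ is monothetic if there is $a\in S$ with $S=\overline{\{a^n:n\ge 1\}}$ (closure in $S$). $S$ is locally compact at $1$ if $1$ has a neighborhood in $S$ whose closure in $S$ is compact. A quasitopological group is a group endowed with a topology such that the multiplication is separately continuous and the inversion $x\mapsto x^{-1}$ is continuous. ''$S$ is a submonoid of $G$'' means that $S$ is a subset of $G$ containing the identity of $G$ and closed under multiplication, with the induced operation and the subspace topology. *)

(* Defs.v *)
From HB Require Import structures.
From mathcomp Require Import all_boot all_classical topology.

Set Implicit Arguments.
Unset Strict Implicit.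
Unset Printing Implicit Defensive.

Local Open Scope classical_set_scope.
Local Open Scope group_scope.

(* As with [PreTopologicalNmodule] in the library, no compatibility between the
   operation and the topology is required here. *)
#[short(type="preTopologicalMonoidType")]
HB.structure Definition PreTopologicalMonoid := {M of Topological M & Monoid M}.

#[short(type="preTopologicalGroupType")]
HB.structure Definition PreTopologicalGroup := {G of Topological G & Group G}.

HB.mixin Record PreTopologicalGroup_isQuasitopologicalGroup G
    & PreTopologicalGroup G := {
  mulgl_continuous : forall a : G, continuous (fun x : G => a * x) ;
  mulgr_continuous : forall a : G, continuous (fun x : G => x * a) ;
  invg_continuous : continuous (fun x : G => x^-1) ;
}.

#[short(type="quasitopologicalGroupType")]
HB.structure Definition QuasitopologicalGroup :=
  {G of PreTopologicalGroup G & PreTopologicalGroup_isQuasitopologicalGroup G}.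

Definition topological_monoid (M : preTopologicalMonoidType) : Prop :=
  continuous (fun p : M * M => p.1 * p.2).

(* The carrier is only a monoid, so the inversion is part of what is asserted
   to exist; it is unique. *)
Definition topological_group (M : preTopologicalMonoidType) : Prop :=
  topological_monoid M /\
  exists inv : M -> M,
    [/\ left_inverse 1 inv *%g, right_inverse 1 inv *%g & continuous inv].

Definition monothetic (M : preTopologicalMonoidType) : Prop :=
  exists a : M, closure [set a ^+ n | n in [set n | (1 <= n)%N]] = [set: M].

Definition locally_compact_at_1 (M : preTopologicalMonoidType) : Prop :=
  exists2 U : set M, nbhs (1 : M) U & compact (closure U).

Record submonoid (G : monoidType) := Submonoid {
  submonoid_set :> set G ;
  submonoid1 : submonoid_set 1 ;
  submonoidM : forall x y,
    submonoid_set x -> submonoid_set y -> submonoid_set (x * y) ;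
}.

Lemma submonoid_closed (G : monoidType) (S : submonoid G) :
  monoid_closed (fun x : G => x \in (S : set G)).
Proof.
split=> [|x y]; rewrite !inE; first exact: submonoid1.
exact: submonoidM.
Qed.

(* The subspace topology on [set_type S] is already provided by the library; the
   following equips it with the induced operation and unit. *)
HB.instance Definition _ (G : preTopologicalMonoidType) (S : submonoid G) :=
  SubType.copy (set_type S) {x : G | x \in (S : set G)}.
HB.instance Definition _ (G : preTopologicalMonoidType) (S : submonoid G) :=
  SubChoice_isSubMonoid.Build G (fun x => x \in (S : set G)) (set_type S)
    (submonoid_closed S).

(* Main.v *)
(* Let a generate S and let C be the closure of S in G. Since inversion in G is
   continuous and a^-1 a^n lies in S for all n >= 1, C contains the inverse of
   every element of S. A compact neighborhood of 1 in S is closed in G, so C and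
   S coincide on some neighborhood V of 1 in G. For x in S some a^n x^-1
   lies in V and hence in S, and likewise some a^-n does; thus a^-1, and then
   x^-1, belong to S. So S is a locally compact monothetic group, and it is
   compact because the powers of a return to a compact neighborhood of 1 with
   bounded gaps. *)

Require Import Defs.
From mathcomp Require Import all_boot all_classical topology.

Set Implicit Arguments.
Unset Strict Implicit.
Unset Printing Implicit Defensive.

Local Open Scope classical_set_scope.

Section MonotheticGroups.
Local Open Scope group_scope.

Lemma submonoidX (G : monoidType) (S : submonoid G) (x : G) n :
  submonoid_set S x -> submonoid_set S (x ^+ n).
Proof.
move=> Sx; elim: n => [|n IHn]; first by rewrite expg0; exact: submonoid1.
by rewrite expgS; exact: submonoidM.
Qed.

(** The trace condition on [V] turns membership in [closure S] into membership in [S] near the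
    identity. So inverses are first found in [closure S], then brought into [V] with the help of
    powers of [a]. *)
Lemma submonoid_invg (G : quasitopologicalGroupType) (S : submonoid G) (a : G)
    (V : set G) :
  submonoid_set S a -> S `<=` closure [set a ^+ n | n in [set n | (1 <= n)%N]] ->
  nbhs 1 V -> V `&` closure S `<=` S ->
  forall x, submonoid_set S x -> submonoid_set S x^-1.
Proof.
move=> Sa dense_a V1 VS.
have clS := @closed_closure _ (S : set G).
(* The preimage of [closure S] under [f] is closed, so testing [f] on the dense powers suffices.
   Exponents start at 1 so that left translation by [a^-1] passes the test. *)
have closure_image (f : G -> G) : continuous f ->
    (forall n, closure S (f (a ^+ n.+1))) ->
    forall x, closure S x -> closure S (f x).
  move=> /continuous_closedP/(_ _ clS) clfS fa.
  change (closure S `<=` f @^-1` closure S).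
  rewrite [X in _ `<=` X](iffLR (closure_id _) clfS).
  apply: subset_trans (closureS dense_a) _.
  rewrite -(iffLR (closure_id _) (@closed_closure _ _)).
  by apply: closureS => _ [[//|n] _ <-]; exact: fa.
have mulVa_closure : forall x, closure S x -> closure S (a^-1 * x).
  apply: closure_image => [|n]; first exact: mulgl_continuous.
  by rewrite expgS mulKg; apply: subset_closure; exact: submonoidX.
have mula_closure : forall x, closure S x -> closure S (a * x).
  apply: closure_image => [|n]; first exact: mulgl_continuous.
  by rewrite -expgS; apply: subset_closure; exact: submonoidX.
have mulX_closure x n : closure S x -> closure S (a ^+ n * x).
  move=> Sx; elim: n => [|n IHn]; first by rewrite expg0 mul1g.
  by rewrite expgS -mulgA; exact: mula_closure.
have aXV_closure n : closure S (a ^+ n)^-1.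
  elim: n => [|n IHn].
    by rewrite expg0 invg1; apply: subset_closure; exact: submonoid1.
  by rewrite expgSr invgM; exact: mulVa_closure.
have inv_closure : forall x, closure S x -> closure S x^-1.
  apply: closure_image => [|n]; last exact: aXV_closure.
  exact: invg_continuous.
have SaV : submonoid_set S a^-1.
  have invV : nbhs (1 : G) [set y | V y^-1].
    by apply: invg_continuous; rewrite invg1.
  (* As 1 is a limit of positive powers, the inverse of some [a ^+ n.+1] lies in [V], hence in [S];
     multiplying it by [a ^+ n] gives [a^-1]. *)
  have [_ [[[//|n] _ <-] /= Van]] := dense_a _ (submonoid1 S) _ invV.
  rewrite -(mulVKg (a ^+ n) a^-1) -invgM -expgS.
  apply: submonoidM; first exact: submonoidX.
  by apply: VS.
move=> x Sx.
have mulxV : nbhs x [set y | V (y * x^-1)].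
  by apply: (@mulgr_continuous G x^-1); rewrite mulgV.
(* For a power of [a] close to [x], the product [a ^+ n * x^-1] lies in [V] and in [closure S],
   hence in [S]. The factor [a ^+ n] is then cancelled by a power of [a^-1]. *)
have [_ [[n _ <-] /= Vanx]] := dense_a _ Sx _ mulxV.
rewrite -(mulKg (a ^+ n) x^-1) -expVgn.
apply: submonoidM; first exact: submonoidX.
by apply: VS; split=> //; apply: mulX_closure; apply: inv_closure; exact: subset_closure.
Qed.

(** Bounded return times to [U] make finitely many translates of [closure U] cover all powers of
    [a]; this finite union is compact, hence closed, and contains a dense set. *)
Lemma compact_monothetic_group (M : preTopologicalMonoidType) :
  hausdorff_space M -> topological_group M -> monothetic M ->
  locally_compact_at_1 M -> compact [set: M].
Proof.
move=> hM [cM [inv [mulVM mulMV _]]] [a dense_a] [U U1 cU].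
have cMl (x : M) : continuous (fun y : M => x * y).
  by move=> y; apply: (@continuous2_cvg _ _ _ _ _ _ (fun _ => x) id
    (fun p q : M => p * q) x y); [exact: (cM (_, _)) | exact: cvg_cst | exact: cvg_id].
have cMr (x : M) : continuous (fun y : M => y * x).
  by move=> y; apply: (@continuous2_cvg _ _ _ _ _ _ id (fun _ => x)
    (fun p q : M => p * q) y x); [exact: (cM (_, _)) | exact: cvg_id | exact: cvg_cst].
have [N returns] : exists N, closure U `<=`
    [set x | exists n, (n < N)%N /\ U (a ^+ n.+1 * x)].
  have /(compact_near_coveringP _) := cU.
  move=> /(_ nat \oo (fun N x => exists n, (n < N)%N /\ U (a ^+ n.+1 * x))).
  case=> [x _|N _ sUN]; last by exists N; apply: sUN => /=.
  (* Landing in the interior of [U] keeps the same exponent valid for all points near [x], as the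
     compactness argument requires. *)
  have nU : nbhs (inv x) [set y | U° (y * x)].
    by apply: cMr; rewrite mulVM; exact: nbhs_interior.
  have : closure [set a ^+ n | n in [set n | (1 <= n)%N]] (inv x).
    by rewrite dense_a.
  move=> /(_ _ nU)[_ [[[//|n] _ <-] /= Uanx]].
  exists ([set y | U (a ^+ n.+1 * y)], [set N | (n < N)%N]).
    split=> /=; last by exists n.+1.
    exact: cMl.
  by move=> [y N] /= [Uy nN]; exists n.
(* Passing from [m] to [m.+1] lowers a positive offset by one; at offset 0, [a ^+ m] is itself in
   [U] and [returns] supplies the next visit, at most [N] steps after [m]. *)
have gaps m : exists j, (j <= N)%N /\ U (a ^+ (m + j)).
  elim: m => [|m [[|j] [jN Uj]]].
  - by exists 0%N; split=> //; rewrite expg0; exact: nbhs_singleton.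
  - rewrite addn0 in Uj.
    have [n [nN]] := returns _ (subset_closure Uj).
    by rewrite -expgnDr => Un; exists n; rewrite addSnnS addnC; split; first exact: ltnW.
  - by exists j; rewrite addSnnS; split; first exact: ltnW.
pose T := \bigcup_(j < N.+1) [set inv (a ^+ j) * x | x in closure U].
have cT : compact T.
  rewrite /T bigcup_mkord; apply: bigsetU_compact => j _; apply: continuous_compact => //.
  exact/continuous_subspaceT.
suff -> : [set: M] = T by [].
apply/seteqP; split=> // x _.
have : closure [set a ^+ n | n in [set n | (1 <= n)%N]] x by rewrite dense_a.
rewrite (iffLR (closure_id T) (compact_closed hM cT)).
apply: closureS => _ [m _ <-].
have [j [jN Uj]] := gaps m.
exists j => //.
exists (a ^+ (m + j)); first exact: subset_closure.
by rewrite addnC expgnDr mulgA mulVM mul1g.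
Qed.

End MonotheticGroups.

Lemma set_type_hausdorff (T : topologicalType) (A : set T) :
  hausdorff_space T -> hausdorff_space (set_type A).
Proof.
move=> hT x y xy; apply: val_inj; apply: hT => B C Bx Cy.
have [z [Bz Cz]] := xy _ _ (initial_continuous Bx) (initial_continuous Cy).
by exists (\val z).
Qed.

Theorem theorem4p2 (G : quasitopologicalGroupType) (S : submonoid G) :
  hausdorff_space G ->
  topological_monoid (set_type S) ->
  monothetic (set_type S) ->
  locally_compact_at_1 (set_type S) ->
  compact [set: set_type S] /\ topological_group (set_type S).
Proof.
move=> hG cM mono lc.
have [a dense_a] := mono.
have [U U1 cU] := lc.
have cval : continuous (\val : set_type S -> G).
  by rewrite -set_valE; exact: initial_continuous.
have valS (x : set_type S) : submonoid_set S (\val x) by exact/set_mem/valP.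
have valX (x : set_type S) n : \val (x ^+ n)%g = (\val x ^+ n)%g.
  by elim: n => [|n IHn]; rewrite ?expg0 ?expgS ?val1 ?valM ?IHn.
have dense_val : S `<=`
    closure [set (\val a ^+ n)%g | n in [set n | (1 <= n)%N]].
  move=> x /mem_set Sx B Bx.
  have : closure [set (a ^+ n)%g | n in [set n | (1 <= n)%N]]
      (exist _ x Sx : set_type S) by rewrite dense_a.
  move=> /(_ _ (cval (exist _ x Sx) _ Bx))[_ [[n n1 <-] Ban]].
  by exists (\val a ^+ n)%g; split; [exists n | rewrite -valX].
(* [V] is open in [G] with trace on [S] inside [U]. A point of [V] adherent to [S] is adherent to
   that trace, hence lies in the image of [closure U], which is compact and so closed in [G]. *)
have [V V1 VS] : exists2 V : set G, nbhs 1%g V & V `&` closure S `<=` S.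
  have [_ [[V oV <-] /= V1 VU]] := U1.
  exists V; first exact: open_nbhs_nbhs.
  have : closed (\val @` closure U).
    apply: compact_closed => //; apply: continuous_compact => //.
    exact/continuous_subspaceT.
  move=> /closure_id clK x [Vx Sx].
  suff : (\val @` closure U) x by move=> [y _ <-].
  rewrite clK => B Bx.
  have [y [Sy [By Vy]]] := Sx _ (filterI Bx (open_nbhs_nbhs (conj oV Vx))).
  exists y; split=> //; exists (exist _ y (mem_set Sy)) => //.
  by apply: subset_closure; exact: VU.
have SV := submonoid_invg (valS a) dense_val V1 VS.
pose inv (x : set_type S) : set_type S :=
  exist (fun y => y \in (S : set G)) _ (mem_set (SV _ (valS x))).
have grp : topological_group (set_type S).
  split=> //; exists inv; split.
  - by move=> x; apply: val_inj; rewrite valM val1 mulVg.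
  - by move=> x; apply: val_inj; rewrite valM val1 mulgV.
  - move=> x C [_ [[B oB <-] Bx BC]].
    have : nbhs x [set y | B (\val y)^-1%g].
      apply: (cval x [set y | B y^-1%g]); apply: invg_continuous.
      exact: open_nbhs_nbhs.
    by apply: filterS => y By; apply: BC; rewrite /= set_valE.
split=> //; apply: compact_monothetic_group => //.
exact: set_type_hausdorff.
Qed.
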